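(* Let $n$ and $m$ be positive integers. If the word problem of $\mathbb{Z}^n$ is an $m$-counter language, then $m \geq n$.
   Context: For a finite set $X$, $X^{\pm}$ denotes $X$ together with formal inverses of its elements, and $\epsilon$ denotes the empty word. If a group $H$ is generated as a group by a finite set $X$, the word problem of $H$ with respect to $X$ is the set of words over $X^{\pm}$ that represent the identity element of $H$. Let $G$ be a group. A $G$-automaton over a finite set $X$ is a finite directed graph (loops and multiple edges allowed) with a distinguished initial vertex, some distinguished final vertices, and with edges labeled by elements of $G \times (X^{\pm} \cup \{\epsilon\})$. Vertices are called states. The label of a path is $(g,w)$, where $g$ is the product in $G$ of the first coordinates of the edge labels along the path and $w$ is the concatenation of the second coordinates. The automaton accepts a word $w$ over $X^{\pm}$ if there is a path from the initial state to some final state labeled $(1,w)$, where $1$ is the identity of $G$. The automaton is nondeterministic in general. The language it accepts is the set of all accepted words. For a positive integer $m$, an $m$-counter automaton is a $\mathbb{Z}^m$-automaton, and an $m$-counter language is a language accepted by some $m$-counter automaton. Convention: ''the word problem of $\mathbb{Z}^n$ is an $m$-counter language'' means that the word problem of $\mathbb{Z}^n$ with respect to some finite generating set is an $m$-counter language (this property is independent of the choice of finite generating set). *)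

(* Defs.v *)
From mathcomp Require Import all_boot all_order all_algebra finmap.

Set Implicit Arguments.
Unset Strict Implicit.
Unset Printing Implicit Defensive.

Local Open Scope group_scope.

(* [(x, false)] is the generator x and [(x, true)] its formal inverse. *)
Definition letter (X : Type) : Type := (X * bool)%type.
Definition word (X : Type) : Type := seq (letter X).

Definition language (X : Type) : Type := word X -> Prop.

Section WordProblem.

Variables (H : groupType) (X : {fset H}).

Definition letter_value (a : letter X) : H :=
  if a.2 then (val a.1)^-1 else val a.1.

Definition word_value (w : word X) : H := \prod_(a <- w) letter_value a.

Definition generates : Prop := forall h : H, exists w : word X, word_value w = h.

Definition word_problem : language X := fun w => word_value w = 1.

End WordProblem.

(* Edges form a type of their own, so that multiple edges are allowed. *)
Record automaton (G : groupType) (X : finType) := Automaton {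
  state : finType;
  edge : finType;
  source : edge -> state;
  target : edge -> state;
  label : edge -> G * option (letter X); (* [None] is the empty word *)
  initial : state;
  final : {set state}
}.

Section Acceptance.

Variables (G : groupType) (X : finType) (A : automaton G X).

Fixpoint is_path (q : state A) (p : seq (edge A)) (r : state A) : bool :=
  if p is e :: p' then (source e == q) && is_path (target e) p' r else q == r.

Definition path_label (p : seq (edge A)) : G * word X :=
  (\prod_(e <- p) (label e).1, pmap (fun e => (label e).2) p).

Definition accepted : language X := fun w =>
  exists (p : seq (edge A)) (r : state A),
    [/\ r \in final A, is_path (initial A) p r & path_label p = (1, w)].

End Acceptance.

(* The additive group of integer row vectors, as a multiplicative group. *)
Definition Zpow (n : nat) : groupType := Algebra.to_multiplicative 'rV[int]_n.

Definition counter_language (m : nat) (X : finType) (L : language X) : Prop :=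
  exists A : automaton (Zpow m) X, forall w : word X, L w <-> accepted A w.

Definition word_problem_is_counter (m : nat) (H : groupType) : Prop :=
  exists X : {fset H}, generates X /\ counter_language m (@word_problem H X).

(* Main.v *)
Require Import Defs.
From mathcomp Require Import all_boot all_order all_algebra finmap boolp zify.

Set Implicit Arguments.
Unset Strict Implicit.
Unset Printing Implicit Defensive.

Import GRing.Theory.

(* Let u_t be a word with value the point (t, ..., t^n) of the moment curve, and
   u'_t a word with the opposite value.  An accepting run on u_t u'_t splits into
   a path y_t (initial to q_t) and a path y'_t (q_t to r_t) with opposite
   counters.  By Higman's lemma, one of these pairs, (x, x'), is a subword of n
   others with the same q and r: y_j is x with some closed walks inserted, and
   likewise for y'_j.  If m < n, the counter increments from x to the y_j satisfy
   a relation with integer coefficients a_j.  Performing the insertions of y_j in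
   x max(a_j, 0) times and those of y'_j in x' max(-a_j, 0) times then yields an
   accepting run, so the word it reads has value 0: the a_j are also a relation
   between differences of points of the moment curve, contradicting Vandermonde. *)

(** * Well-quasi-orders and Higman's lemma *)

(** The predicate [P] restricts the carrier, so that words over a subalphabet, or avoiding a given
    word, keep the type [seq T]. *)
Definition wqo_on (T : Type) (P : T -> Prop) (R : T -> T -> Prop) : Prop :=
  forall f : nat -> T, (forall i, P (f i)) ->
  exists i j, (i < j)%N /\ R (f i) (f j).

Lemma infinitely_often_subsequence (P : nat -> Prop) :
  (forall N, exists2 i, (N < i)%N & P i) ->
  exists2 h : nat -> nat, {homo h : i j / (i < j)%N} & forall i, P (h i).
Proof.
move=> /(_ _)/cid2-/all_sig2[g ltg Pg].
exists (fun i => iter i.+1 g 0%N) => [|i]; last exact: Pg.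
by apply: homo_ltn => [? ? ?|i]; [apply: ltn_trans | apply: ltg].
Qed.

(** Only finitely many terms lack a later term above them, since infinitely many would form a
    sequence without a good pair. Beyond these, successors are chosen one by one and transitivity
    does the rest. *)
Lemma wqo_ascending (T : Type) (P : T -> Prop) (R : T -> T -> Prop)
    (f : nat -> T) :
  (forall y x z, R x y -> R y z -> R x z) -> wqo_on P R ->
  (forall i, P (f i)) ->
  exists2 h : nat -> nat, {homo h : i j / (i < j)%N} &
    forall i j, (i < j)%N -> R (f (h i)) (f (h j)).
Proof.
move=> Rtr wqo Pf.
have [N HN] : exists N, forall i, (N < i)%N -> exists2 j, (i < j)%N & R (f i) (f j).
  apply: contrapT => noN.
  have /infinitely_often_subsequence[h h_lt hP] N :
      exists2 i, (N < i)%N & forall j, (i < j)%N -> ~ R (f i) (f j).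
    apply: contrapT => no_i; apply: noN; exists N => i Ni.
    apply: contrapT => no_j; apply: no_i; exists i => // j ij Rij.
    by apply: no_j; exists j.
  have [i [j [ij Rij]]] := wqo (f \o h) (fun i => Pf (h i)).
  exact: hP (h_lt _ _ ij) Rij.
(* Up to [N] the successor is a dummy [i.+1]; starting [h] at [N.+1] keeps the guard true. *)
have next i : {j | (i < j)%N & (N < i)%N -> R (f i) (f j)}.
  apply: cid2; have [/HN[j ij Rij]|_] := ltnP N i; first by exists j.
  by exists i.+1.
pose h i := iter i (fun i => s2val (next i)) N.+1.
have h_lt i : (h i < h i.+1)%N by rewrite /h /=; case: (next _).
have h_homo : {homo h : i j / (i < j)%N} by apply: homo_ltn => // ? ? ?; apply: ltn_trans.
exists h => //; apply: homo_ltn => // i /=.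
have : (N < h i)%N by elim: i => // i /ltn_trans; apply.
by rewrite /h /=; case: (next _).
Qed.

Lemma wqo_sub (T : Type) (P Q : T -> Prop) (R : T -> T -> Prop) :
  (forall x, P x -> Q x) -> wqo_on Q R -> wqo_on P R.
Proof. by move=> PQ wqo f Pf; apply: wqo => i; apply: PQ. Qed.

Lemma wqo_union (T : Type) (P Q : T -> Prop) (R : T -> T -> Prop) :
  wqo_on P R -> wqo_on Q R -> wqo_on (fun x => P x \/ Q x) R.
Proof.
move=> wqoP wqoQ f PQf.
have [[N HN]|noN] := pselect (exists N, forall i, (N < i)%N -> Q (f i)).
  have [i [j [ij Rij]]] := wqoQ (fun i => f (N.+1 + i)%N) (fun i => HN _ (leq_addr _ _)).
  by exists (N.+1 + i)%N, (N.+1 + j)%N; rewrite ltn_add2l.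
have /infinitely_often_subsequence[h h_lt hP] N : exists2 i, (N < i)%N & P (f i).
  apply: contrapT => no_i; apply: noN; exists N => i Ni.
  by have [Pi|//] := PQf i; case: no_i; exists i.
have [i [j [ij Rij]]] := wqoP (f \o h) hP.
by exists (h i), (h j); rewrite h_lt.
Qed.

(** Along an [R]-ascending subsequence of first components every pair of indices is good for [R], so
    one good pair for [S] suffices. *)
Lemma wqo_prod (T U : Type) (P : T -> Prop) (Q : U -> Prop)
    (R : T -> T -> Prop) (S : U -> U -> Prop) :
  (forall y x z, R x y -> R y z -> R x z) -> wqo_on P R -> wqo_on Q S ->
  wqo_on (fun x => P x.1 /\ Q x.2) (fun x y => R x.1 y.1 /\ S x.2 y.2).
Proof.
move=> Rtr wqoP wqoQ f PQf.
have [h h_lt hR] := wqo_ascending Rtr wqoP (fun i => proj1 (PQf i)).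
have [i [j [ij Sij]]] := wqoQ (fun i => (f (h i)).2) (fun i => proj2 (PQf (h i))).
by exists (h i), (h j); split; [apply: h_lt | split=> //; apply: hR].
Qed.

Lemma wqo_image (T U : Type) (P : T -> Prop) (R : T -> T -> Prop)
    (S : U -> U -> Prop) (g : T -> U) :
  (forall x y, R x y -> S (g x) (g y)) -> wqo_on P R ->
  wqo_on (fun u => exists2 x, P x & u = g x) S.
Proof.
move=> g_mono wqoP f /(_ _)/cid2-/all_sig2[f' Pf' fE].
have [i [j [ij Rij]]] := wqoP f' Pf'.
by exists i, j; rewrite !fE; split=> //; apply: g_mono.
Qed.

Lemma wqo_eq (T : finType) : wqo_on (fun _ : T => True) eq.
Proof.
move=> f _; apply: contrapT => no_pair.
suff /leq_card : injective (fun i : 'I_(#|T|.+1) => f i) by rewrite card_ord ltnn.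
have neq i j : (i < j)%N -> f i <> f j by move=> ij fij; apply: no_pair; exists i, j.
move=> i j fij; apply: val_inj; case: (ltngtP i j) => // ij; first by case: (neq _ _ ij).
by case: (neq _ _ ij).
Qed.

Lemma split_first (T : eqType) (a : T) (s : seq T) :
  a \in s -> exists s1 s2, s = s1 ++ a :: s2 /\ a \notin s1.
Proof.
elim: s => // b s IHs; rewrite inE; have [<- _|neq_ab /= /IHs[s1 [s2 [-> a_s1]]]] := eqVneq.
  by exists [::], s.
by exists (b :: s1), s2; rewrite inE negb_or neq_ab.
Qed.

(* A word over A avoiding a :: w as a subword either misses a, or is u a v with
   u missing a and v avoiding w. *)
Lemma wqo_avoid (T : finType) (A : {set T}) (w : seq T) :
  (forall a, a \in A -> wqo_on (fun s : seq T => {subset s <= A :\ a}) subseq) ->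
  {subset w <= A} ->
  wqo_on (fun s : seq T => {subset s <= A} /\ ~~ subseq w s) subseq.
Proof.
move=> IH; elim: w => [|a w IHw] wA; first by move=> f /(_ 0%N)[_]; rewrite sub0seq.
have aA : a \in A by apply: wA; rewrite mem_head.
have {}IHw := IHw (fun x xw => wA x (@mem_behead _ (a :: w) x xw)).
have cat_mono (p p' : seq T * seq T) : subseq p.1 p'.1 /\ subseq p.2 p'.2 ->
    subseq (p.1 ++ a :: p.2) (p'.1 ++ a :: p'.2).
  by case=> sub1 sub2; apply: cat_subseq => //=; rewrite eqxx.
have wqo2 := wqo_image (g := fun p => p.1 ++ a :: p.2) (S := subseq)
  cat_mono (wqo_prod (@subseq_trans T) (IH a aA) IHw).
apply: wqo_sub (wqo_union (IH a aA) wqo2) => s [sA avoid].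
have [a_s|/negP a_s] := boolP (a \in s); last first.
  by left=> x xs; rewrite !inE sA // andbT; apply: contraPneq a_s => <-.
right; have [u [v [sE a_u]]] := split_first a_s; exists (u, v) => //=.
split; last split.
- move=> x xu; rewrite !inE; apply/andP; split; first by apply: contraNneq a_u => <-.
  by apply: sA; rewrite sE mem_cat xu.
- by move=> x xv; apply: sA; rewrite sE mem_cat inE xv !orbT.
- apply: contra avoid => wv; rewrite sE; apply: subseq_trans (suffix_subseq _ _).
  by rewrite /= eqxx.
Qed.

(** Induction on the size of [A]: either [f 0] embeds in a later term, or all later terms avoid it
    and [wqo_avoid] reduces to the smaller alphabets [A :\ a]. *)
Lemma higman_alphabet (T : finType) (A : {set T}) :
  wqo_on (fun s : seq T => {subset s <= A}) subseq.
Proof.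
have [k] := ubnP #|A|; elim: k A => // k IHk A; rewrite ltnS => leAk f fA.
have [[j j0 f0j]|no_j] := pselect (exists2 j, (0 < j)%N & subseq (f 0%N) (f j)).
  by exists 0%N, j.
have wqo_f0 : wqo_on (fun s : seq T => {subset s <= A} /\ ~~ subseq (f 0%N) s) subseq.
  apply: wqo_avoid (fA 0%N) => a aA; apply: IHk.
  by apply: leq_trans leAk; rewrite [in leqRHS](cardsD1 a) aA.
have [i|i [j [ij fij]]] := wqo_f0 (fun i => f i.+1).
  by split=> //; apply/negP => f0i; apply: no_j; exists i.+1.
by exists i.+1, j.+1.
Qed.

Lemma higman (T : finType) : wqo_on (fun _ : seq T => True) subseq.
Proof.
by apply: (wqo_sub _ (@higman_alphabet T setT)) => s _ x _; rewrite inE.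
Qed.

(** * Amalgamating paths *)

Section Paths.

Variables (G : groupType) (X : finType) (A : automaton G X).
Implicit Types (q r : state A) (p x y z w : seq (edge A)).

Lemma is_path_cat q p1 p2 r :
  is_path q (p1 ++ p2) r <-> exists2 s, is_path q p1 s & is_path s p2 r.
Proof.
elim: p1 q => [|e p1 IHp] q /=.
  by split=> [|[s /eqP->]//]; exists q.
split=> [/andP[-> /IHp[s]]|[s /andP[-> p1s] sr]]; first by exists s.
by apply/IHp; exists s.
Qed.

(* In a path, each gap of the subsequence x is a closed walk, so the insertions
   turning x into y and into z can be made simultaneously. *)
Lemma path_amalgam q r x y z :
  is_path q x r -> is_path q y r -> is_path q z r ->
  subseq x y -> subseq x z ->
  exists w, [/\ is_path q w r, subseq x w & perm_eq (x ++ w) (y ++ z)].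
Proof.
elim: x q y z => [|e x IHx] q y z.
  move=> /eqP <- yq zq _ _; exists (y ++ z); split=> //; last exact: sub0seq.
  by apply/is_path_cat; exists q.
(* Cutting at the first occurrence of [e] leaves the longest remainder, so [x] still embeds in
   it. *)
have split_at s : is_path q s r -> subseq (e :: x) s -> exists s1 s2,
    [/\ s = s1 ++ e :: s2, is_path q s1 (source e), is_path (target e) s2 r & subseq x s2].
  move=> sr sub; have /split_first[s1 [s2 [sE e_s1]]] : e \in s.
    by apply: mem_subseq sub _ _; rewrite mem_head.
  exists s1, s2; move: sr; rewrite sE => /is_path_cat[s' ps1 /= /andP[/eqP-> ps2]].
  split=> //; move: sub; rewrite sE; elim: s1 e_s1 {sE ps1} => [_ /=|b s1 IH].
    by rewrite eqxx.
  by rewrite inE negb_or /= => /andP[/negPf-> /IH].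
move=> /= /andP[/eqP qE xr] /split_at H1 /split_at H2 /H1[y1 [y2 [-> py1 py2 xy2]]].
move=> /H2[z1 [z2 [-> pz1 pz2 xz2]]].
have [w [wr xw eq_w]] := IHx _ _ _ xr py2 pz2 xy2 xz2.
(* As [source e] is [q], both [y1] and [z1] are closed walks at [q] and can be run in succession
   before the shared edge [e]. *)
exists (y1 ++ z1 ++ e :: w); split.
- apply/is_path_cat; exists q; first by rewrite -{2}qE.
  by apply/is_path_cat; exists (source e); rewrite //= eqxx.
- apply: subseq_trans (suffix_subseq _ _); apply: subseq_trans (suffix_subseq _ _).
  by rewrite /= eqxx.
- apply/permP => b; move/permP/(_ b): eq_w; rewrite !count_cat /= ?count_cat /=.
  lia.
Qed.

(** Iterates [path_amalgam], using each [y j] exactly [k j] times. The path is chosen before [V] and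
    [F], so a single [w] accounts for both counters and values. *)
Lemma path_pump q r x (J : finType) (y : J -> seq (edge A)) (k : J -> nat) :
  is_path q x r -> (forall j, is_path q (y j) r) -> (forall j, subseq x (y j)) ->
  exists2 w, is_path q w r & forall (V : zmodType) (F : edge A -> V),
    (\sum_(e <- w) F e =
     \sum_(e <- x) F e + \sum_j (\sum_(e <- y j) F e - \sum_(e <- x) F e) *+ k j)%R.
Proof.
move=> xr yr xy.
have pump_seq (s : seq J) : exists w, [/\ is_path q w r, subseq x w &
    forall (V : zmodType) (F : edge A -> V), (\sum_(e <- w) F e =
     \sum_(e <- x) F e + \sum_(j <- s) (\sum_(e <- y j) F e - \sum_(e <- x) F e))%R].
  elim: s => [|j s [w [wr xw wE]]]; first by exists x; split=> // V F; rewrite big_nil addr0.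
  have [w' [wr' xw' eq_w']] := path_amalgam xr wr (yr j) xw (xy j).
  exists w'; split=> // V F; apply: (@addrI _ (\sum_(e <- x) F e)%R).
  rewrite -big_cat (perm_big _ eq_w') /= big_cat /= wE big_cons /=.
  by rewrite -addrA; congr (_ + _)%R; rewrite addrA subrKC addrC.
have [w [wr _ wE]] := pump_seq (flatten [seq nseq (k j) j | j <- index_enum J]).
exists w => // V F; rewrite wE big_flatten big_map; congr (_ + _)%R.
by apply: eq_bigr => j _; rewrite big_nseq iter_addr_0.
Qed.

End Paths.

(** * Integer linear algebra *)

Local Open Scope ring_scope.

(** In the Smith form [L D R] of [M], the row of index [m] of [D] lies below the diagonal and
    vanishes; the same row of the inverse of [L] is the relation. *)
Lemma rows_dependent (n m : nat) (M : 'M[int]_(n, m)) :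
  (m < n)%N -> exists2 a : 'rV[int]_n, a != 0 & a *m M = 0.
Proof.
move=> ltmn; have [L Lu [R _ [d _ ->]]] := int_Smith_normal_form M.
pose i := Ordinal ltmn; exists (row i (invmx L)).
  apply/negP => /eqP row0; have : row i (1%:M : 'M[int]_n) = 0.
    by rewrite -(mulVmx Lu) row_mul row0 mul0mx.
  by move/rowP/(_ i)/eqP; rewrite !mxE eqxx.
rewrite -!row_mul !mulmxA mulVmx // mul1mx row_mul.
rewrite (_ : row i _ = 0) ?mul0mx //; apply/rowP => j; rewrite !mxE /=.
by rewrite gtn_eqF.
Qed.

Definition moment_point (n t : nat) : 'rV[int]_n := \row_i t%:Z ^+ i.+1.

(** Giving [t0] the coefficient minus the sum of the [a 0 j] turns the relation into a kernel vector
    [b] of a Vandermonde matrix with [n.+1] distinct nodes. *)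
Lemma moment_points_independent (n : nat) (t0 : nat) (t : 'I_n -> nat)
    (a : 'rV[int]_n) :
  injective t -> (forall j, t j != t0) ->
  \sum_j a 0 j *: (moment_point n (t j) - moment_point n t0) = 0 -> a = 0.
Proof.
move=> t_inj t_neq sum0.
pose b : 'rV[int]_n.+1 :=
  \row_j (if unlift ord0 j is Some j' then a 0 j' else - \sum_j' a 0 j').
pose s : 'rV[int]_n.+1 := \row_j (if unlift ord0 j is Some j' then t j' else t0)%:Z.
have s0 : s 0 ord0 = t0 by rewrite mxE unlift_none.
have sS (j : 'I_n) : s 0 (lift ord0 j) = t j by rewrite mxE liftK.
have b0 : b 0 ord0 = - \sum_j a 0 j by rewrite mxE unlift_none.
have bS (j : 'I_n) : b 0 (lift ord0 j) = a 0 j by rewrite mxE liftK.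
have s_inj : injective (s 0).
  move=> i j; case: (unliftP ord0 i) => [i'|] ->; case: (unliftP ord0 j) => [j'|] ->;
    rewrite ?s0 ?sS // => -[].
  - by move=> /t_inj ->.
  - by move=> E; case/eqP: (t_neq i').
  - by move=> E; case/eqP: (t_neq j').
have Vb0 : Vandermonde n.+1 s *m b^T = 0.
  apply/colP => i; rewrite [RHS]mxE [LHS]mxE.
  under eq_bigr => j _ do rewrite [Vandermonde _ _ _ _]mxE [b^T _ _]mxE.
  rewrite big_ord_recl; under eq_bigr => j _ do rewrite sS bS.
  rewrite s0 b0.
  (* Row 0, of exponent 0, is the sum of the coefficients of [b]; the other rows are the coordinates
     of [sum0]. *)
  case: (unliftP ord0 i) => [i'|] ->; last first.
    by rewrite expr0 mul1r addrC (eq_bigr (a 0)) ?subrr // => j _; rewrite expr0 mul1r.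
  move/rowP/(_ i'): sum0; rewrite summxE mxE => sum0; rewrite -[RHS]sum0.
  rewrite mulrN mulr_sumr -sumrN -big_split /=; apply: eq_bigr => j _.
  by rewrite !mxE /= addrC mulrBr ![a 0 j * _]mulrC.
have det_neq0 : \det (Vandermonde n.+1 s) != 0.
  rewrite det_Vandermonde; apply/prodf_neq0 => i _; apply/prodf_neq0 => j ij.
  by rewrite subr_eq0; apply: contraTneq ij => /s_inj ->; rewrite ltnn.
(* The determinant need not be a unit of [int], so the adjugate replaces the inverse. *)
have bT0 : b^T = 0.
  move/(congr1 (mulmx (\adj (Vandermonde n.+1 s)))): Vb0.
  rewrite mulmxA mul_adj_mx mulmx0 mul_scalar_mx => /colP V0; apply/colP => i.
  move/eqP: (V0 i); rewrite [_ i _]mxE [X in _ == X]mxE mulf_eq0 (negPf det_neq0).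
  by move=> /eqP ->; rewrite mxE.
by apply/rowP => j; rewrite -bS -[b]trmxK bT0 !mxE.
Qed.

(** * Accepting runs *)

Lemma pmap_split (T U : Type) (f : T -> option U) p (u v : seq U) :
  pmap f p = u ++ v -> exists p1 p2, [/\ p = p1 ++ p2, pmap f p1 = u & pmap f p2 = v].
Proof.
elim: p u => [|e p IHp] u /=.
  by case: u => //= <-; exists [::], [::].
case fe: (f e) => [a|] /=; last first.
  by move=> /IHp[p1 [p2 [-> <- <-]]]; exists (e :: p1), p2; rewrite /= fe.
case: u => [/= <-|b u [<- /IHp[p1 [p2 [-> <- <-]]]]].
  by exists [::], (e :: p); rewrite /= fe.
by exists (e :: p1), p2; rewrite /= fe.
Qed.

Section AcceptingRuns.

Variables (n m : nat) (X : {fset Zpow n}) (A : automaton (Zpow m) X).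
Hypothesis accepts_wp : forall w, word_problem w <-> accepted A w.
Hypothesis gen : generates X.

(** The type ascription passes from the multiplicative [Zpow m] to additive vectors, where sums
    along runs make sense. *)
Definition edge_counter (e : edge A) : 'rV[int]_m := (label e).1.
Definition edge_value (e : edge A) : 'rV[int]_n :=
  if (label e).2 is Some a then letter_value a else 0.

Lemma sum_edge_value (p : seq (edge A)) :
  \sum_(e <- p) edge_value e = word_value (path_label p).2 :> 'rV[int]_n.
Proof.
elim: p => [|e p IHp]; first by rewrite /word_value !big_nil.
rewrite big_cons IHp /edge_value /word_value /=; case: (label e).2 => [a|] /=.
  by rewrite big_cons.
by rewrite add0r.
Qed.

Lemma accepted_value0 (p : seq (edge A)) (r : state A) :
  r \in final A -> is_path (initial A) p r ->
  \sum_(e <- p) edge_counter e = 0 -> \sum_(e <- p) edge_value e = 0.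
Proof.
move=> rF pr C0; rewrite sum_edge_value; apply/accepts_wp; exists p, r; split=> //.
by rewrite /path_label; congr (_, _).
Qed.

(** A word for [v] followed by one for [- v] lies in the word problem; its accepting run is cut
    where the first word has been read. *)
Lemma split_run (v : 'rV[int]_n) :
  exists (qr : state A * state A) (p : seq (edge A) * seq (edge A)),
    [/\ qr.2 \in final A, is_path (initial A) p.1 qr.1, is_path qr.1 p.2 qr.2,
        \sum_(e <- p.1) edge_counter e + \sum_(e <- p.2) edge_counter e = 0 &
        \sum_(e <- p.1) edge_value e = v /\ \sum_(e <- p.2) edge_value e = - v].
Proof.
have [u uE] := gen v; have [u' uE'] := gen (- v).
have : word_problem (u ++ u').
  rewrite /word_problem /word_value big_cat.
  move: uE uE'; rewrite /word_value => -> ->; exact: (@subrr 'rV[int]_n).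
case/accepts_wp => p [r [rF pr [C0 wE]]].
have [p1 [p2 [pE p1E p2E]]] := pmap_split wE.
move: pr; rewrite pE => /is_path_cat[q p1q p2r].
exists (q, r), (p1, p2); split=> //; last first.
  by rewrite !sum_edge_value /path_label /= p1E p2E.
by rewrite -big_cat -pE; exact: C0.
Qed.

Lemma counters_ge_rank : (n <= m)%N.
Proof.
rewrite leqNgt; apply/negP => ltmn.
have [qr /(_ _)/cid-/all_sig[p run]] := choice (fun t => split_run (moment_point n t)).
pose f t := (qr t, p t).
have wqo_run : wqo_on (fun _ => True) (fun
    x y : (state A * state A) * (seq (edge A) * seq (edge A)) =>
    x.1 = y.1 /\ subseq x.2.1 y.2.1 /\ subseq x.2.2 y.2.2).
  have eq_tr (y x z : state A * state A) : x = y -> y = z -> x = z by move=> -> ->.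
  have := wqo_prod eq_tr (@wqo_eq _)
    (wqo_prod (@subseq_trans (edge A)) (@higman (edge A)) (@higman (edge A))).
  by apply: wqo_sub.
have [|h h_lt hE] := wqo_ascending (f := f) _ wqo_run (fun=> I).
  move=> y x z [-> [xy1 xy2]] [-> [yz1 yz2]].
  by split=> //; split; [apply: subseq_trans xy1 yz1 | apply: subseq_trans xy2 yz2].
set t0 := h 0%N; pose t (j : 'I_n) := h j.+1.
have qrE j : qr (t j) = qr t0 by have [/= <-] := hE 0%N j.+1 isT.
have sub1 j : subseq (p t0).1 (p (t j)).1 by have [_ []] := hE 0%N j.+1 isT.
have sub2 j : subseq (p t0).2 (p (t j)).2 by have [_ []] := hE 0%N j.+1 isT.
have [rF x1q x2r Cx [Vx1 Vx2]] := run t0.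
have y1q j : is_path (initial A) (p (t j)).1 (qr t0).1.
  by have [_ + _ _ _] := run (t j); rewrite qrE.
have y2r j : is_path (qr t0).1 (p (t j)).2 (qr t0).2.
  by have [_ _ + _ _] := run (t j); rewrite qrE.
pose C (s : seq (edge A)) := \sum_(e <- s) edge_counter e.
pose V (s : seq (edge A)) := \sum_(e <- s) edge_value e.
have [a a_neq0 aC0] := rows_dependent (\matrix_j (C (p (t j)).1 - C (p t0).1)) ltmn.
(* Positive and negative parts of [a 0 j]; [Negz k] stands for [-(k+1)], hence [k.+1]. *)
pose kp j := if a 0 j is Posz k then k else 0%N.
pose kn j := if a 0 j is Negz k then k.+1 else 0%N.
have aE (W : lmodType int) (d : W) j : a 0 j *: d = d *+ kp j - d *+ kn j.
  rewrite -[a 0 j]intz scaler_int /kp /kn.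
  by case: (a 0 j) => k; rewrite ?intz ?mulr0n ?subr0 ?sub0r.
have [w1 w1q w1E] := path_pump kp x1q y1q sub1.
have [w2 w2r w2E] := path_pump kn x2r y2r sub2.
(* When the two halves of every run have opposite [F]-sums, an insertion in the second half undoes
   the matching one in the first. This is how negative coefficients are realised by nonnegative
   numbers of insertions. *)
have combine (W : lmodType int) (F : edge A -> W) :
    (forall s, \sum_(e <- (p s).1) F e + \sum_(e <- (p s).2) F e = 0) ->
    \sum_(e <- w1 ++ w2) F e =
    \sum_j a 0 j *: (\sum_(e <- (p (t j)).1) F e - \sum_(e <- (p t0).1) F e).
  move=> F0; rewrite big_cat /= w1E w2E addrACA F0 add0r -big_split /=.
  apply: eq_bigr => j _; rewrite aE; congr (_ + _); rewrite -mulNrn opprB; congr (_ *+ _).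
  have E s : \sum_(e <- (p s).2) F e = - \sum_(e <- (p s).1) F e.
    by apply/eqP; rewrite -addr_eq0 addrC F0.
  by rewrite !E opprK addrC.
have w_path : is_path (initial A) (w1 ++ w2) (qr t0).2.
  by apply/is_path_cat; exists (qr t0).1.
(* [combine] is applied first to counters, where the relation [aC0] gives acceptance, and then to
   values, where it gives a relation on the moment curve. *)
have V0 : V (w1 ++ w2) = 0.
  apply: accepted_value0 rF w_path _.
  rewrite combine => [|s]; last by have [] := run s.
  move/rowP: aC0 => aC0; apply/rowP => i; rewrite -aC0 summxE mxE.
  by apply: eq_bigr => j _; rewrite !mxE.
move: V0; rewrite /V combine => [sum0|s]; last first.
  by have [_ _ _ _ [-> ->]] := run s; rewrite subrr.
case/eqP: a_neq0; apply: (@moment_points_independent n t0 t).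
- by move=> i j /eqP; rewrite /t; case: (ltngtP i j) => [ij|ij|/val_inj //];
    have := h_lt i.+1 j.+1; have := h_lt j.+1 i.+1; rewrite !ltnS; lia.
- by move=> j; rewrite gtn_eqF // h_lt.
- rewrite -[RHS]sum0; apply: eq_bigr => j _.
  by have [_ _ _ _ [-> _]] := run (t j); rewrite Vx1.
Qed.

End AcceptingRuns.

Theorem theorem1 (n m : nat) (n_gt0 : (0 < n)%N) (m_gt0 : (0 < m)%N) :
  word_problem_is_counter m (Zpow n) -> (n <= m)%N.
Proof.
by case=> X [gen [A acc]]; apply: counters_ge_rank acc gen.
Qed.
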